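(* Let $A=\{a_1<\ldots<a_N\}$ be a finite set of $N\ge 2$ positive real numbers. Let $f_1,f_2:[a_1,\infty)\to\mathbb{R}$ be continuous, strictly increasing and strictly convex functions, and suppose that $(h_1,h_1',h_2,h_2')$ is $W$-good for $(f_1,f_2)$, for some $W$. Suppose that $A$ satisfies the spacing condition \[ \min\{a_{i+1}-a_i : 1\le i\le N-1\}\ \ge\ \max\{h_1'-h_1,\ h_2'-h_2\}. \] Then \begin{multline*} |2f_1(A+h_1)-2f_1(A+h_1)+2f_1(A+h_1')-f_1(A+h_1')|\\ \cdot\,|2f_2(A+h_2)-2f_2(A+h_2)+2f_2(A+h_2')-f_2(A+h_2')| \gg \frac{N^5}{(W\log N)^3}. \end{multline*}
   Context: Definition ($W$-good). Let $f_1,f_2:[u,\infty)\to\mathbb{R}$ be continuous, strictly increasing and strictly convex, and let $W$ be a non-negative integer. The quadruple $(h_1,h_1',h_2,h_2')$ of reals is $W$-good for $(f_1,f_2)$ if $h_1'>h_1>0$, $h_2'>h_2>0$, and there is a partition $[u,\infty)=I_1\sqcup\cdots\sqcup I_W$ into intervals such that for each $j\in\{1,\dots,W\}$ the curve \[ \{(f_1(t+h_1')-f_1(t+h_1),\ f_2(t+h_2')-f_2(t+h_2)) : t\in I_j\} \] is the graph of a strictly convex or strictly concave function. In the claim, $u=a_1$. Notation: $f(A+h)=\{f(a+h):a\in A\}$; for $S,T\subset\mathbb{R}$, $S\pm T=\{s\pm t : s \in S, t \in T\}$ and $2S=S+S$ (sumset). $|\cdot|$ is cardinality. $X\gg Y$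 means $X\ge cY$ for some absolute constant $c>0$. *)

(* Defs.v *)
From HB Require Import structures.
From mathcomp Require Import all_boot all_order all_algebra.
From mathcomp Require Import finmap.
From mathcomp Require Import all_classical all_reals all_analysis.
Import Order.TTheory GRing.Theory Num.Theory numFieldNormedType.Exports.

Set Implicit Arguments.
Unset Strict Implicit.
Unset Printing Implicit Defensive.

Local Open Scope classical_set_scope.
Local Open Scope fset_scope.
Local Open Scope ring_scope.

(* A function with domain D is modelled as a total function R -> R of which
   only the values on D matter. *)

Definition strictly_increasing_on (R : realType) (D : set R) (f : R -> R) : Prop :=
  forall x y, D x -> D y -> x < y -> f x < f y.

(* As usual, convexity of a function presupposes a convex domain. *)
Definition strictly_convex_on (R : realType) (D : set R) (f : R -> R) : Prop :=
  is_interval D /\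
  forall x y t, D x -> D y -> x != y -> 0 < t < 1 ->
    f (t * x + (1 - t) * y) < t * f x + (1 - t) * f y.

Definition strictly_concave_on (R : realType) (D : set R) (f : R -> R) : Prop :=
  is_interval D /\
  forall x y t, D x -> D y -> x != y -> 0 < t < 1 ->
    t * f x + (1 - t) * f y < f (t * x + (1 - t) * y).

Definition graph_on (R : realType) (D : set R) (g : R -> R) : set (R * R) :=
  [set (x, g x) | x in D].

Definition diff_curve (R : realType) (f1 f2 : R -> R) (h1 h1' h2 h2' : R)
    (I : set R) : set (R * R) :=
  [set (f1 (t + h1') - f1 (t + h1), f2 (t + h2') - f2 (t + h2)) | t in I].

(* (h1, h1', h2, h2') is W-good for f1, f2 : [u, +oo) -> R *)
Definition W_good (R : realType) (W : nat) (u : R) (f1 f2 : R -> R)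
    (h1 h1' h2 h2' : R) : Prop :=
  [/\ 0 < h1 < h1', 0 < h2 < h2' &
    exists I : 'I_W -> set R,
      [/\ partition [set: 'I_W] I `[u, +oo[%classic,
          forall j, is_interval (I j) &
          forall j, exists (D : set R) (g : R -> R),
            diff_curve f1 f2 h1 h1' h2 h2' (I j) = graph_on D g /\
            (strictly_convex_on D g \/ strictly_concave_on D g)]].

Definition shift_image (R : realType) (f : R -> R) (A : {fset R}) (h : R) : {fset R} :=
  [fset f (x + h) | x in A].

Definition sumset (R : realType) (S T : {fset R}) : {fset R} :=
  [fset s + t | s in S, t in T].

Definition diffset (R : realType) (S T : {fset R}) : {fset R} :=
  [fset s - t | s in S, t in T].

(* 2 f(A+h) - 2 f(A+h) + 2 f(A+h') - f(A+h'), where 2 S = S + S *)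
Definition expander (R : realType) (f : R -> R) (A : {fset R}) (h h' : R) : {fset R} :=
  let B := shift_image f A h in
  let B' := shift_image f A h' in
  diffset (sumset (diffset (sumset B B) (sumset B B)) (sumset B' B')) B'.

(* Main.v *)
(* By strict convexity d_i(t) = f_i(t + h_i') - f_i(t + h_i) increases with t.
   Among the N/2 smallest elements of A, pigeonhole selects N/(2W) in one piece
   of the partition; let (x_l, y_l) be their images on the curve (d_1, d_2).
   Convexity or concavity makes the vectors (x_(l+1) - x_l, y_(l+1) - y_l)
   pairwise distinct.  For each l, all the x-gaps not longer than the l-th one
   fit in the l-th one, so 2D_1 - D_1 has at least sum_l r_l elements between the
   extreme x_l, where r_l is the rank of the l-th x-gap among the distinct
   x-gaps; likewise 2D_2 - D_2 has at least sum_l q_l.  The lattice points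
   (r_l, q_l) are distinct, so the product of the two sums is >> (N/W)^3.
   Each of these elements can be added to f_i(t + h_i) without exceeding
   f_i(t + h_i') for t in the upper half of A, and the spacing condition makes
   these intervals disjoint, which gives another factor N in each coordinate.
   This avoids dyadic pigeonholing, so the logarithms are not even needed. *)
Require Import Defs.
From HB Require Import structures.
From mathcomp Require Import all_boot all_order all_algebra.
From mathcomp Require Import finmap.
From mathcomp Require Import all_classical all_reals all_analysis.
From mathcomp Require Import zify ring lra.
Import Order.TTheory GRing.Theory Num.Theory numFieldNormedType.Exports.

(** * Counting in the naturals: averages, lattice points, pigeonhole, constants *)

(** Markov's inequality: the selected indices are those where [r] exceeds three times its mean. *)
Lemma card_many_small (n : nat) (r : 'I_n -> nat) :
  (3 * #|[set i | 3 * (\sum_k r k) < n * r i]| <= n)%N.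
Proof.
set S := (\sum_k r k)%N; set A := [set i | _].
have H : (#|A| * (3 * S) <= n * S)%N.
  rewrite -sum_nat_const.
  apply: (@leq_trans (\sum_(i in A) n * r i)).
    by apply: leq_sum => i; rewrite inE => /ltnW.
  rewrite -big_distrr /= leq_mul2l; apply/orP; right.
  by rewrite /S [leqRHS](bigID (mem A)) /= leq_addr.
have [S0|Spos] := posnP S; last by nia.
suff -> : A = finset.set0 by rewrite cards0.
apply/setP => i; rewrite !inE S0.
have: (r i <= S)%N by rewrite /S (bigD1 i) //= leq_addr.
by rewrite S0 leqn0 => /eqP ->; rewrite !muln0.
Qed.

(* At least a third of the points have [r i <= 3 (\sum r) / n] and
   [q i <= 3 (\sum q) / n], and this box contains at most [9 (\sum r) (\sum q) / n ^ 2] lattice points. *)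
Lemma lattice_points_sums (n : nat) (r q : 'I_n -> nat) :
  (forall i, 0 < r i)%N -> (forall i, 0 < q i)%N ->
  injective (fun i => (r i, q i)) ->
  (n ^ 3 <= 27 * ((\sum_i r i) * (\sum_i q i)))%N.
Proof.
move=> r0 q0 inj.
have [n0|n0] := posnP n; first by rewrite {1}n0.
have cA := @card_many_small n r; have cB := @card_many_small n q.
set Sr := (\sum_i r i)%N in cA *; set Sq := (\sum_i q i)%N in cB *.
set A := [set i | _] in cA; set B := [set i | _] in cB.
set C := ~: (A :|: B).
have cC : (n <= 3 * #|C|)%N.
  have := cardsC (A :|: B); rewrite -/C card_ord.
  have := cardsU A B; lia.
set X := (3 * Sr %/ n)%N; set Y := (3 * Sq %/ n)%N.
have cXY : (#|C| <= X * Y)%N.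
  pose F (i : 'I_n) : 'I_X.+1 * 'I_Y.+1 := (inord (r i), inord (q i)).
  have rq i : i \in C -> (r i <= X)%N && (q i <= Y)%N.
    rewrite !inE negb_or -!leqNgt => /andP[h1 h2].
    by rewrite !leq_divRL // ![(_ * n)%N]mulnC h1 h2.
  have -> : #|C| = #|F @: C|.
    rewrite card_in_imset // => i j /rq/andP[ri qi] /rq/andP[rj qj] [].
    move=> /(congr1 val) /=; rewrite !inordK // => eqr.
    move=> /(congr1 val) /=; rewrite !inordK // => eqq.
    by apply: inj; rewrite eqr eqq.
  (* Ranging over positive coordinates only gives [X * Y] cells instead of [X.+1 * Y.+1]. *)
  have -> : (X * Y = #|finset.setX [set~ ord0] [set~ ord0 : 'I_Y.+1] : {set 'I_X.+1 * 'I_Y.+1}|)%N.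
    by rewrite cardsX !cardsC1 !card_ord.
  apply/subset_leq_card/fintype.subsetP => _ /imsetP[i iC ->].
  have /andP[ri qi] := rq _ iC.
  by rewrite !inE -!val_eqE /= !inordK // -!lt0n r0 q0.
have hX : (X * n <= 3 * Sr)%N by exact: leq_trunc_div.
have hY : (Y * n <= 3 * Sq)%N by exact: leq_trunc_div.
have h1 := leq_mul hX hY.
have h2 : (n * n ^ 2 <= 3 * (X * Y) * n ^ 2)%N by rewrite leq_mul2r; apply/orP; right; lia.
nia.
Qed.

Lemma pigeonhole_seq (T : Type) (W : nat) (s : seq T) (P : 'I_W -> pred T) :
  all (fun x => [exists j, P j x]) s -> (0 < size s)%N ->
  exists j, (size s <= W * count (P j) s)%N.
Proof.
move=> sP s0.
have H : (size s <= \sum_j count (P j) s)%N.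
  elim: s sP {s0} => [|x s IH] //= /andP[/existsP[j jx] /IH h].
  rewrite big_split /= -addn1 addnC leq_add //.
  by rewrite (bigD1 j) //= jx.
apply/existsP; apply: contraT; rewrite negb_exists => /forallP small.
have : (W * (\sum_j count (P j) s) <= W * (size s).-1)%N.
  rewrite big_distrr /= -[in leqRHS](card_ord W) -sum_nat_const.
  by apply: leq_sum => j _; have := small j; lia.
case: W P sP H small => [|W] P sP H small; last by nia.
by move: H; rewrite big_ord0; lia.
Qed.

(** The constant is 4 * 27 * 216 = 4 * 18^3: the 4 from N <= 2 (N - N/2), the 27 from N <= 3 W (n +
    1), and 216 = 8 * 27 from n + 1 <= 2n. This last step fails for [n = 0], which [maxn 1]
    covers. *)
Lemma expander_product_bound {N W n r q e1 e2 : nat} :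
  (1 < N)%N -> (N./2 <= W * n.+1)%N -> (n ^ 3 <= 27 * (r * q))%N ->
  ((N - N./2) * maxn 1 r <= e1)%N -> ((N - N./2) * maxn 1 q <= e2)%N ->
  (N ^ 5 <= 4 * 18 ^ 3 * W ^ 3 * (e1 * e2))%N.
Proof.
move=> N2 sz_j nrq E1ge E2ge.
have n1 : (n.+1 ^ 3 <= 216 * (maxn 1 r * maxn 1 q))%N.
  have rq : (r * q <= maxn 1 r * maxn 1 q)%N by rewrite leq_mul // leq_maxr.
  have rq1 : (1 * 1 <= maxn 1 r * maxn 1 q)%N by rewrite leq_mul // leq_maxl.
  have : (n.+1 ^ 3 <= maxn 1 (8 * n ^ 3))%N.
    case: (n) => [|k] //; rewrite leq_max; apply/orP; right.
    by rewrite -[8%N]/(2 ^ 3)%N -expnMn leq_exp2r //; lia.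
  lia.
have N3 : (N ^ 3 <= 27 * (W ^ 3 * n.+1 ^ 3))%N.
  by rewrite -[27%N]/(3 ^ 3)%N -!expnMn leq_exp2r //; lia.
have NN : (N ^ 2 <= 4 * (N - N./2) ^ 2)%N.
  by rewrite -[4%N]/(2 ^ 2)%N -expnMn leq_exp2r //; lia.
have E12 := leq_mul E1ge E2ge.
have -> : (N ^ 5 = N ^ 2 * N ^ 3)%N by rewrite -expnD.
apply: (leq_trans (leq_mul NN N3)).
have := leq_mul (leqnn (4 * 27 * W ^ 3 * (N - N./2) ^ 2)%N) n1.
have := leq_mul (leqnn (4 * 18 ^ 3 * W ^ 3)%N) E12.
nia.
Qed.

Local Open Scope classical_set_scope.
Local Open Scope fset_scope.
Local Open Scope ring_scope.

(** * Strict convexity, and packing into disjoint intervals *)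

(** Both [x + d] and [y] are convex combinations of [x] and [y + d], with swapped weights; the two
    convexity inequalities are added. *)
Lemma strictly_convex_increment {R : realType} {D : set R} {g : R -> R} {x y d : R} :
  strictly_convex_on D g -> D x -> D (y + d) -> x < y -> 0 < d ->
  g (x + d) - g x < g (y + d) - g y.
Proof.
move=> [_ cvx] Dx Dyd xy d0.
have e0 : 0 < y - x + d by lra.
have ne : x != y + d by apply/eqP; lra.
pose t := d / (y - x + d).
have t01 : 0 < t < 1.
  by rewrite /t divr_gt0 //= ltr_pdivrMr //; lra.
have t01' : 0 < 1 - t < 1 by lra.
have td : t * (y - x + d) = d by rewrite /t divfK // gt_eqF.
have := cvx _ _ _ Dx Dyd ne t01; have := cvx _ _ _ Dx Dyd ne t01'.
have -> : (1 - t) * x + (1 - (1 - t)) * (y + d) = x + d by rewrite -[in RHS]td; ring.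
have -> : t * x + (1 - t) * (y + d) = y.
  have -> : t * x + (1 - t) * (y + d) = y + d - t * (y - x + d) by ring.
  by rewrite td; ring.
lra.
Qed.

Lemma strictly_concave_oppr {R : realType} {D : set R} {g : R -> R} :
  strictly_concave_on D g -> strictly_convex_on D (fun x => - g x).
Proof.
move=> [Di ccv]; split => // x y t Dx Dy xy t01.
by have := ccv x y t Dx Dy xy t01; lra.
Qed.

(** The sums [lo i + t] lie in half-open intervals (lo i, hi i], which may touch but not meet. This
    serves both for the gaps and for the upper half of [a]. *)
Lemma card_disjoint_intervals {R : realType} (K : nat) (lo hi : nat -> R)
    (T : nat -> {fset R}) (E : {fset R}) :
  (forall i j, (i < j < K)%N -> hi i <= lo j) ->
  (forall i t, (i < K)%N -> t \in T i ->
     [/\ 0 < t, lo i + t <= hi i & lo i + t \in E]) ->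
  (\sum_(i < K) #|` T i| <= #|` E|)%N.
Proof.
move=> dis TE.
pose s := [seq lo i + t | i <- iota 0 K, t <- enum_fset (T i)].
have -> : (\sum_(i < K) #|` T i| = size s)%N.
  rewrite size_allpairs_dep sumnE big_map -[K in iota 0 K]subn0.
  by rewrite -/(index_iota 0 K) big_mkord.
apply: uniq_leq_size; last first.
  move=> _ /allpairsPdep[i [t [iK tT ->]]].
  by rewrite mem_iota in iK; have [] := TE i t iK tT.
apply: allpairs_uniq_dep; first exact: iota_uniq.
  by move=> i _; exact: fset_uniq.
move=> [i t] [j u] /allpairsPdep[i' [t' [iK tT /= [-> ->]]]].
move=> /allpairsPdep[j' [u' [jK uT /= [-> ->]]]].
rewrite !mem_iota /= in iK jK.
have [t0 thi _] := TE _ _ iK tT; have [u0 uhi _] := TE _ _ jK uT.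
have [ij|ij|<-] := ltngtP i' j'.
- by move=> e; exfalso; have := dis i' j'; rewrite ij jK => /(_ isT); lra.
- by move=> e; exfalso; have := dis j' i'; rewrite ij iK => /(_ isT); lra.
- by move=> /addrI ->.
Qed.

(** * Ranks of consecutive gaps *)

Definition values {R : realType} (n : nat) (v : nat -> R) : {fset R} :=
  [fset v i | i in iota 0 n].

(** Distinct values are counted, not indices, so that equal ranks mean equal values and pairs of
    gaps become lattice points. *)
Definition rank {R : realType} (n : nat) (v : nat -> R) (i : nat) : nat :=
  #|` [fset t in values n v | t <= v i]|.

Lemma rank_gt0 {R : realType} (n : nat) (v : nat -> R) (i : nat) : (i < n)%N -> (0 < rank n v i)%N.
Proof.
move=> iN; rewrite cardfs_gt0; apply/fset0Pn; exists (v i).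
by rewrite !inE /= lexx andbT; apply/imfsetP; exists i => //=; rewrite mem_iota.
Qed.

Lemma rank_inj {R : realType} (n : nat) (v : nat -> R) (i j : nat) : (i < n)%N -> (j < n)%N ->
  rank n v i = rank n v j -> v i = v j.
Proof.
wlog : i j / v i <= v j.
  move=> H iN jN e; have [h|/ltW h] := leP (v i) (v j); first exact: H.
  by apply/esym/H.
move=> vij iN jN e; apply/le_anti; rewrite vij /=.
have sub : [fset t in values n v | t <= v i] `<=` [fset t in values n v | t <= v j].
  apply/fsubsetP => t; rewrite !inE /= => /andP[-> /=] h; exact: le_trans h vij.
have /eqP/esym E : [fset t in values n v | t <= v i] == [fset t in values n v | t <= v j].
  by rewrite eqEfcard sub /= -/(rank n v i) -/(rank n v j) e leqnn.
have : v j \in [fset t in values n v | t <= v j].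
  by rewrite !inE /= lexx andbT; apply/imfsetP; exists j => //=; rewrite mem_iota.
by rewrite E !inE /= => /andP[].
Qed.

Definition gap {R : realType} (x : nat -> R) (i : nat) : R := x i.+1 - x i.

(** Each distinct gap not longer than the [i]-th, added to [x i], stays in (x i, x i.+1]. *)
Lemma sum_rank_gap_le {R : realType} (n : nat) (x : nat -> R) (E : {fset R}) :
  (forall i j, (i < j <= n)%N -> x i < x j) ->
  (forall i k, (i < n)%N -> (k < n)%N -> gap x k <= gap x i ->
     x i + gap x k \in E) ->
  (\sum_(i < n) rank n (gap x) i <= #|` E|)%N.
Proof.
move=> xinc xE.
apply: (card_disjoint_intervals n x (fun i => x i.+1)
          (fun i => [fset t in values n (gap x) | t <= gap x i])).
- move=> i j /andP[]; rewrite leq_eqVlt => /orP[/eqP->//|ij] jn.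
  by apply/ltW/xinc; rewrite ij ltnW.
- move=> i t iN; rewrite !inE /= => /andP[/imfsetP[k /= + ->] ki].
  rewrite mem_iota /= add0n => kn; split; last exact: xE.
  + by rewrite subr_gt0 xinc // ltnSn.
  + by move: ki; rewrite /gap; lra.
Qed.

(** Over steps of equal length, a strictly convex function gains strictly more further to the
    right. *)
Lemma gap_inj_convex {R : realType} {D : set R} {g : R -> R} (n : nat)
    (x y : nat -> R) (i k : nat) :
  strictly_convex_on D g ->
  (forall l, (l <= n)%N -> D (x l) /\ y l = g (x l)) ->
  (forall i j, (i < j <= n)%N -> x i < x j) ->
  (i < n)%N -> (k < n)%N -> gap x i = gap x k -> gap y i = gap y k -> i = k.
Proof.
move=> cvx Dx xinc.
wlog ik : i k / (i < k)%N.
  move=> H iN kN e1 e2; have [ik|ik|//] := ltngtP i k; first exact: H.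
  by apply/esym/H.
move=> iN kN e1 e2.
have gi : x i + gap x i = x i.+1 by rewrite /gap; ring.
have gk : x k + gap x i = x k.+1 by rewrite e1 /gap; ring.
have [Di yi] := Dx i (ltnW iN); have [_ yi'] := Dx i.+1 iN.
have [_ yk] := Dx k (ltnW kN); have [Dk yk'] := Dx k.+1 kN.
have := strictly_convex_increment (x := x i) (y := x k) (d := gap x i) cvx Di.
rewrite gi gk -yi -yi' -yk -yk' => /(_ Dk).
have -> : x i < x k by apply: xinc; rewrite ik ltnW.
rewrite subr_gt0 xinc ?ltnSn // => /(_ isT isT).
by move: e2; rewrite /gap => ->; rewrite ltxx.
Qed.

(** * Increments and the size of one expander *)

Definition increment {R : realType} (f : R -> R) (h h' t : R) : R :=
  f (t + h') - f (t + h).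

(** Regrouping leaves two plus and two minus terms at [h], two plus and one minus at [h']. *)
Lemma mem_expander {R : realType} (f : R -> R) (A : {fset R}) (h h' t t1 t2 t3 : R) :
  t \in A -> t1 \in A -> t2 \in A -> t3 \in A ->
  f (t + h) + (increment f h h' t1 + increment f h h' t2 - increment f h h' t3)
    \in expander f A h h'.
Proof.
move=> tA t1A t2A t3A.
have sh k u : u \in A -> f (u + k) \in shift_image f A k by move=> uA; exact: in_imfset.
have -> : f (t + h) + (increment f h h' t1 + increment f h h' t2 - increment f h h' t3)
  = ((f (t + h) + f (t3 + h)) - (f (t1 + h) + f (t2 + h)))
    + (f (t1 + h') + f (t2 + h')) - f (t3 + h') by rewrite /increment; ring.
by do !apply: in_imfset2; exact: sh.
Qed.

Lemma increment_lt {R : realType} (f : R -> R) (u h h' s t : R) :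
  strictly_convex_on `[u, +oo[%classic f -> 0 < h < h' -> u <= s -> s < t ->
  increment f h h' s < increment f h h' t.
Proof.
move=> cvx /andP[h0 hh] us st.
have := strictly_convex_increment (x := s + h) (y := t + h) (d := h' - h) cvx.
rewrite /= !in_itv /= !andbT /increment.
have -> : s + h + (h' - h) = s + h' by ring.
have -> : t + h + (h' - h) = t + h' by ring.
by apply; lra.
Qed.

(* The elements of [D + D - D], [D] being the set of increments, which lie
   between two increments at points of the lower half of [a] are squeezed
   between [f (t + h)] and [f (t + h')] for every [t] in the upper half. *)
Lemma card_expander_ge {R : realType} (f : R -> R) (h h' : R) (a s : seq R) (n : nat) :
  sorted <%R a -> 0 < h < h' ->
  (forall i, (i.+1 < size a)%N -> h' - h <= a`_i.+1 - a`_i) ->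
  strictly_increasing_on `[a`_0, +oo[%classic f ->
  strictly_convex_on `[a`_0, +oo[%classic f ->
  subseq s (take (size a)./2 a) -> size s = n.+1 ->
  ((size a - (size a)./2)
     * maxn 1 (\sum_(i < n) rank n (gap (fun l => increment f h h' s`_l)) i)
   <= #|` expander f [fset x in a] h h'|)%N.
Proof.
move=> sa hh spacing finc fcvx sub szs.
have /andP[h0 hlt] := hh.
set half := (size a)./2; set A := [fset x in a].
pose x l := increment f h h' s`_l.
have half_le : (half <= size a)%N by rewrite /half; lia.
have ltna i j : (i < j < size a)%N -> a`_i < a`_j.
  move=> /andP[ij ja]; apply: (sorted_ltn_nth lt_trans) => //.
  by rewrite inE (ltn_trans ij).
have lena i j : (i <= j < size a)%N -> a`_i <= a`_j.
  move=> /andP[]; rewrite leq_eqVlt => /orP[/eqP->//|ij] ja.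
  by apply/ltW/ltna; rewrite ij.
have mem_a t : t \in a -> a`_0 <= t.
  by move=> /(nthP 0)[i ia <-]; apply: lena.
have ss : sorted <%R s.
  by apply: (subseq_sorted lt_trans sub); exact: take_sorted.
have s_low l : (l <= n)%N -> exists2 k, (k < half)%N & s`_l = a`_k.
  move=> ln; have : s`_l \in take half a.
    by apply: (mem_subseq sub); rewrite mem_nth // szs.
  move=> /(nthP 0)[k]; rewrite size_takel // => kh <-.
  by exists k => //; rewrite nth_take.
have mem_s l : (l <= n)%N -> s`_l \in a.
  by move=> /s_low[k kh ->]; rewrite mem_nth // (leq_trans kh).
have xinc i j : (i < j <= n)%N -> x i < x j.
  move=> /andP[ij jn].
  apply: (increment_lt _ _ _ _ _ _ fcvx) => //.
    by apply/mem_a/mem_s; rewrite (leq_trans (ltnW ij)).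
  apply: (sorted_ltn_nth lt_trans) => //; rewrite inE szs ?ltnS //.
  by rewrite (leq_trans (ltnW ij)).
have xle i j : (i <= j <= n)%N -> x i <= x j.
  move=> /andP[]; rewrite leq_eqVlt => /orP[/eqP->//|ij] jn.
  by apply/ltW/xinc; rewrite ij.
pose D := [fset increment f h h' t | t in A].
have xD l : (l <= n)%N -> x l \in D.
  by move=> ln; apply: in_imfset; rewrite /= inE mem_s.
pose S := [fset z in diffset (sumset D D) D | x 0%N <= z <= x n].
have inS i k l : (i <= n)%N -> (k <= n)%N -> (l <= n)%N ->
    x 0%N <= x i + x k - x l <= x n -> x i + x k - x l \in S.
  move=> ?? ? xx; rewrite !inE /= xx andbT.
  by apply: in_imfset2; [apply: in_imfset2|]; exact: xD.
have S_ge : (maxn 1 (\sum_(i < n) rank n (gap x) i) <= #|` S|)%N.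
  rewrite geq_max; apply/andP; split.
    (* This is [x 0] itself, which keeps [S] nonempty even for [n = 0]. *)
    rewrite cardfs_gt0; apply/fset0Pn; exists (x 0%N + x 0%N - x 0%N).
    by apply: (inS 0%N 0%N 0%N) => //; rewrite addrK lexx xle ?leqnn.
  apply: sum_rank_gap_le => // i k iN kN.
  rewrite /gap => ki; rewrite addrA; apply: inS => //; first exact: ltnW.
    exact: ltnW.
  have := xle 0%N i (ltnW iN); have := xle i.+1 n.
  rewrite iN leqnn => /(_ isT) ? ?.
  have := xinc k k.+1; rewrite ltnSn kN => /(_ isT) ?.
  by apply/andP; split; lra.
apply: (leq_trans (leq_mul (leqnn _) S_ge)).
rewrite -[X in (X * _)%N]card_ord -sum_nat_const.
pose p i := a`_(half + i).
have p_in i : (i < size a - half)%N -> p i \in a.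
  by move=> iN; rewrite mem_nth // -ltn_subRL.
apply: (card_disjoint_intervals _ (fun i => f (p i + h)) (fun i => f (p i + h'))
          (fun _ => S)).
  move=> i j /andP[ij jK].
  (* The spacing condition makes the intervals from [f (p i + h)] to [f (p i + h')]
     non-overlapping. *)
  have pij : p i + h' <= p j + h.
    have := spacing (half + i)%N; have := lena (half + i).+1 (half + j)%N.
    rewrite /p; have -> : ((half + i).+1 <= half + j < size a)%N by lia.
    have -> : ((half + i).+1 < size a)%N by lia.
    by move=> /(_ isT) ? /(_ isT) ?; lra.
  have pi0 : a`_0 <= p i by apply/mem_a/p_in/(ltn_trans ij).
  have pj0 : a`_0 <= p j by apply/mem_a/p_in.
  move: pij; rewrite le_eqVlt => /orP[/eqP->//|pij].
  by apply/ltW/finc => //=; rewrite in_itv /= andbT; lra.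
move=> i z iK; rewrite !inE /= => /andP[zD /andP[z0 zn]].
have pi0 : a`_0 <= p i by apply/mem_a/p_in.
have s00 : a`_0 <= s`_0 by apply/mem_a/mem_s.
(* As [f] increases, increments are positive, hence so is all of [S]. *)
have x0 : 0 < x 0%N.
  rewrite subr_gt0; apply: finc; rewrite /= ?in_itv /= ?andbT; lra.
(* The point [s_n] is in the lower half and [p i] in the upper half. *)
have xn : x n < increment f h h' (p i).
  have [k kh sk] := s_low n (leqnn n).
  apply: (increment_lt _ _ _ _ _ _ fcvx) => //; first exact/mem_a/mem_s.
  by rewrite sk ltna // (leq_trans kh (leq_addr _ _)) -ltn_subRL.
split; [lra | by move: xn; rewrite /increment; lra |].
move: zD => /imfset2P[/= y yD [_ /imfsetP[/= t3 t3A ->] ->]].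
move: yD => /imfset2P[/= _ /imfsetP[/= t1 t1A ->] [_ /imfsetP[/= t2 t2A ->] ->]].
by apply: mem_expander => //; rewrite inE p_in.
Qed.

(** * Choice of a piece of the partition and assembly of the bounds *)

(* The list a enumerates A = {a_1 < ... < a_N}, with a_(i+1) written a`_i. *)
Theorem theorem2p6 (R : realType) :
  exists c : R, 0 < c /\
  forall (N W : nat) (a : seq R) (f1 f2 : R -> R) (h1 h1' h2 h2' : R),
    let A := [fset x in a] in
    let dom := `[a`_0, +oo[%classic in
    size a = N -> (2 <= N)%N ->
    sorted <%R a -> (forall x, x \in A -> 0 < x) ->
    {within dom, continuous f1} ->
    strictly_increasing_on dom f1 ->
    strictly_convex_on dom f1 ->
    {within dom, continuous f2} ->
    strictly_increasing_on dom f2 ->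
    strictly_convex_on dom f2 ->
    W_good W a`_0 f1 f2 h1 h1' h2 h2' ->
    (forall i : nat, (i.+1 < N)%N ->
       Num.max (h1' - h1) (h2' - h2) <= a`_i.+1 - a`_i) ->
    c * (N%:R ^+ 5 / (W%:R * ln (N%:R : R)) ^+ 3)
      <= #|` expander f1 A h1 h1'|%:R * #|` expander f2 A h2 h2'|%:R.
Proof.
(* The denominator comes from [expander_product_bound]; the numerator absorbs the logarithms through
   [ln 2 <= ln N]. *)
exists (ln 2%:R ^+ 3 / (4 * 18 ^+ 3)); split.
  by rewrite divr_gt0 ?exprn_gt0 ?mulr_gt0 ?exprn_gt0 ?ln_gt0 ?ltr1n.
move=> N W a f1 f2 h1 h1' h2 h2' A dom sza N2 sa _ _ f1inc f1cvx _ f2inc f2cvx.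
move=> [hh1 hh2 [I [[cov _ _] _ piece]]] spacing.
set E1 := expander _ _ _ _; set E2 := expander f2 _ _ _.
pose P (j : 'I_W) (t : R) := `[< I j t >].
have half_gt0 : (0 < N./2)%N by lia.
have sz_half : size (take N./2 a) = N./2 by rewrite size_takel // sza; lia.
have mem_a t : t \in a -> dom t.
  move=> /(nthP 0)[i ia <-]; rewrite /dom /= in_itv /= andbT.
  case: i ia => // i ia; apply/ltW/(sorted_ltn_nth lt_trans) => //.
  by rewrite inE (leq_ltn_trans _ ia).
have [j sz_j] : exists j, (N./2 <= W * count (P j) (take N./2 a))%N.
  rewrite -{1}sz_half; apply: pigeonhole_seq; last by rewrite sz_half.
  apply/allP => t /mem_take /mem_a; rewrite /dom -cov => -[j _ It].
  by apply/existsP; exists j; apply/asboolP.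
set s := [seq t <- take N./2 a | P j t].
have sub : subseq s (take N./2 a) by exact: filter_subseq.
rewrite -size_filter -/s in sz_j.
have [n szs] : exists n, size s = n.+1 by exists (size s).-1; lia.
rewrite szs in sz_j.
have spacing1 i : (i.+1 < size a)%N -> h1' - h1 <= a`_i.+1 - a`_i.
  by rewrite sza => /spacing; rewrite ge_max => /andP[].
have spacing2 i : (i.+1 < size a)%N -> h2' - h2 <= a`_i.+1 - a`_i.
  by rewrite sza => /spacing; rewrite ge_max => /andP[].
pose x l := increment f1 h1 h1' s`_l; pose y l := increment f2 h2 h2' s`_l.
have sub' : subseq s (take (size a)./2 a) by rewrite sza.
have := card_expander_ge f1 h1 h1' a s n sa hh1 spacing1 f1inc f1cvx sub' szs.
have := card_expander_ge f2 h2 h2' a s n sa hh2 spacing2 f2inc f2cvx sub' szs.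
rewrite -/A -/E1 -/E2 -/x -/y sza.
have ss : sorted <%R s.
  by apply: (subseq_sorted lt_trans sub); exact: take_sorted.
have mem_s l : (l <= n)%N -> s`_l \in s by move=> ln; rewrite mem_nth // szs.
have xinc i k : (i < k <= n)%N -> x i < x k.
  move=> /andP[ik kn]; have iN := leq_trans (ltnW ik) kn.
  apply: (increment_lt _ _ _ _ _ _ f1cvx) => //.
    have := mem_a _ (mem_take (mem_subseq sub (mem_s i iN))).
    by rewrite /dom /= in_itv /= andbT.
  by apply: (sorted_ltn_nth lt_trans) => //; rewrite inE szs ltnS.
have gap_inj i k : (i < n)%N -> (k < n)%N ->
    gap x i = gap x k -> gap y i = gap y k -> i = k.
  move=> iN kN ex ey.
  have [D [g [curve cvx]]] := piece j.
  have xy l : (l <= n)%N -> D (x l) /\ y l = g (x l).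
    move=> /mem_s; rewrite mem_filter => /andP[/asboolP Il _].
    have : graph_on D g (x l, y l) by rewrite -curve; exists s`_l.
    by move=> [z Dz [zx zy]]; rewrite -zx -zy.
  (* A concave piece is reflected: negating [y] makes it convex and preserves equality of gaps. *)
  case: cvx => [cvx|/strictly_concave_oppr cvx].
    exact: (gap_inj_convex n x y i k cvx).
  apply: (gap_inj_convex n x (fun l => - y l) i k cvx) => //.
    by move=> l /xy[? ->].
  by move: ey; rewrite /gap; lra.
have := lattice_points_sums n (fun i => rank n (gap x) i) (fun i => rank n (gap y) i).
move=> /(_ (fun i => rank_gt0 n _ _ (ltn_ord i)) (fun i => rank_gt0 n _ _ (ltn_ord i))).
set r := (\sum_(i < n) rank n (gap x) i)%N; set q := (\sum_(i < n) rank n (gap y) i)%N.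
have inj : injective (fun i : 'I_n => (rank n (gap x) i, rank n (gap y) i)).
  move=> i k [ex ey]; apply: val_inj.
  apply: gap_inj; rewrite ?ltn_ord //.
    exact: (rank_inj n (gap x) i k (ltn_ord i) (ltn_ord k) ex).
  exact: (rank_inj n (gap y) i k (ltn_ord i) (ltn_ord k) ey).
move=> /(_ inj) nrq E2ge E1ge.
have bound := expander_product_bound N2 sz_j nrq E1ge E2ge.
have W0 : (0 < W)%N by rewrite lt0n; apply: contraTneq sz_j => ->; rewrite -ltnNge.
have ln2_gt0 : 0 < ln (2%:R : R) by rewrite ln_gt0 // ltr1n.
have lnN : ln (2%:R : R) <= ln (N%:R : R).
  by rewrite ler_ln ?posrE ?ltr0n ?ler_nat // (ltn_trans _ N2).
have lnN_gt0 := lt_le_trans ln2_gt0 lnN.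
have : (N%:R : R) ^+ 5 <= 4 * 18 ^+ 3 * W%:R ^+ 3 * (#|` E1|%:R * #|` E2|%:R).
  by rewrite -!natrX -!natrM ler_nat.
have W0' : 0 < (W%:R : R) by rewrite ltr0n.
set e := #|` E1|%:R * #|` E2|%:R => boundR.
have WL : 0 < (W%:R * ln (N%:R : R)) ^+ 3 by rewrite exprn_gt0 // mulr_gt0.
rewrite mulrA ler_pdivrMr // exprMn.
have e0 : 0 <= e by rewrite mulr_ge0.
have ln3 : ln (2%:R : R) ^+ 3 <= ln (N%:R : R) ^+ 3 by rewrite lerXn2r // nnegrE ltW.
have := ler_pM _ _ ln3 boundR.
rewrite !exprn_ge0 ?ler0n ?(ltW ln2_gt0) // => /(_ isT isT).
lra.
Qed.
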